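(* Let $P$ (clean data) and $\tilde P$ (noisily labeled data) be probability distributions of $(\mathbf X,Y)$ and $(\mathbf X,\tilde Y)$ respectively on $\mathbb R^M\times\{c_1,\dots,c_{n_c}\}$, having the same marginal distribution of the feature vector $\mathbf X$. Let $\mathbf D$ be the matrix of a ground metric on the classes $\{c_1,\dots,c_{n_c}\}$ and let $W$ be the Wasserstein distance with cost matrix $\mathbf D$ between probability vectors of length $n_c$. For $\theta\subseteq\{1,\dots,M\}$ set $$d_1(\theta)=\mathbb E_{\mathbf X}\,W[p(Y\mid\mathbf X),\,p(Y\mid\mathbf X_\theta)],\qquad d_2(\theta)=\mathbb E_{\mathbf X}\,W[p(\tilde Y\mid\mathbf X),\,p(\tilde Y\mid\mathbf X_\theta)],$$ and let $$\epsilon_1=\mathbb E_{\mathbf X}\,W[p(Y\mid\mathbf X),\,p(\tilde Y\mid\mathbf X)].$$ Let $K\in\{0,1,\dots,M\}$, let $\theta_1^*$ be a minimizer of $d_1(\theta)$ and $\theta_2^*$ a minimizer of $d_2(\theta)$ over all $\theta\subseteq\{1,\dots,M\}$ with $|\theta|=K$. Then $$d_1(\theta_2^* )-d_1(\theta_1^* )\le 4\epsilon_1.$$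
   Context: For $\theta\subseteq\{1,\dots,M\}$, $\mathbf X_\theta$ denotes the subvector of $\mathbf X=(X_1,\dots,X_M)$ with coordinates indexed by $\theta$. $p(Y\mid\mathbf X)$ and $p(Y\mid\mathbf X_\theta)$ are the conditional distributions (probability vectors of length $n_c$) of the label given $\mathbf X$, respectively $\mathbf X_\theta$, under $P$; $p(\tilde Y\mid\mathbf X)$ and $p(\tilde Y\mid\mathbf X_\theta)$ are those under $\tilde P$. No relation between $Y$ and $\tilde Y$ (no noise model) is assumed beyond the equality of the marginals of $\mathbf X$. Expectations are with respect to the common marginal distribution of $\mathbf X$. Wasserstein distance: for probability vectors $\mathbf p,\mathbf q\in\mathbb R^{n_c}$, $$W[\mathbf p,\mathbf q]=\min\Big\{\operatorname{tr}(\mathbf Q^\top\mathbf D)=\sum_{i,j}Q_{i,j}D_{i,j}\;:\;\mathbf Q\in\mathbb R^{n_c\times n_c},\ \mathbf Q\mathbf 1=\mathbf p,\ \mathbf Q^\top\mathbf 1=\mathbf q,\ Q_{i,j}\ge 0\ \forall i,j\Big\}.$$ Ground metric: $D_{i,j}=d(c_i,c_j)$ where $d$ is a metric on $\{c_1,\dots,c_{n_c}\}$ (so $D$ is symmetric, vanishes exactly on the diagonal, and satisfies the triangle inequality). *)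

(* Defs.v *)
From HB Require Import structures.
From mathcomp Require Import all_boot all_order all_algebra.
From mathcomp Require Import all_classical all_reals all_analysis.

Set Implicit Arguments.
Unset Strict Implicit.
Unset Printing Implicit Defensive.

Import Order.TTheory GRing.Theory Num.Theory.
Import numFieldTopology.Exports numFieldNormedType.Exports.

Local Open Scope classical_set_scope.
Local Open Scope ring_scope.

(* The n.+1 classes c_1, ..., c_{n.+1} are encoded by their index in 'I_n.+1;
   every set of classes is measurable. (A probability on R^M * {classes} forces
   the number of classes to be positive.) *)
HB.instance Definition _ (n : nat) := isPointed.Build 'I_n.+1 ord0.
HB.instance Definition _ (n : nat) :=
  @isMeasurable.Build default_measure_display 'I_n.+1 discrete_measurable
    discrete_measurable0 discrete_measurableC discrete_measurableU.

Section wasserstein.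
Context {R : realType} {n : nat}.
Implicit Types (p q : 'cV[R]_n) (Q D : 'M[R]_n).

Definition prob_vec p : Prop :=
  (forall i, 0 <= p i ord0) /\ \sum_i p i ord0 = 1.

Definition coupling p q : set 'M[R]_n :=
  [set Q | [/\ Q *m const_mx 1 = p, Q^T *m const_mx 1 = q
             & forall i j, 0 <= Q i j]].

(* For probability vectors this infimum is attained, hence a minimum: see
   [wasserstein_min] below. *)
Definition wasserstein D p q : R :=
  inf [set \tr (Q^T *m D) | Q in coupling p q].

Lemma coupling_entry p q Q i : coupling p q Q -> \sum_j Q i j = p i ord0.
Proof.
case=> <- _ _; rewrite mxE; apply: eq_bigr => j _; by rewrite mxE mulr1.
Qed.

Lemma coupling_le1 p q Q i j : prob_vec p -> coupling p q Q -> Q i j <= 1.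
Proof.
move=> [p0 p1] cQ; apply: (@le_trans _ _ (p i ord0)).
  rewrite -(coupling_entry i cQ) (bigD1 j)//= lerDl.
  by case: cQ => _ _ Q0; apply: sumr_ge0.
by rewrite -p1 (bigD1 i)//= lerDl; apply: sumr_ge0.
Qed.

Lemma coupling_prod p q : prob_vec p -> prob_vec q -> coupling p q (p *m q^T).
Proof.
move=> [p0 p1] [q0 q1]; split.
- apply/matrixP => i k; rewrite ord1 mxE -[RHS]mulr1 -[in RHS]q1 mulr_sumr.
  by apply: eq_bigr => j _; rewrite !mxE big_ord1 !mxE mulr1.
- apply/matrixP => i k; rewrite ord1 mxE -[RHS]mul1r -[in RHS]p1 mulr_suml.
  by apply: eq_bigr => j _; rewrite !mxE big_ord1 !mxE mulr1.
- by move=> i j; rewrite mxE big_ord1 mxE mulr_ge0.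
Qed.

Lemma wasserstein_min D p q : prob_vec p -> prob_vec q ->
  exists2 Q, coupling p q Q &
    wasserstein D p q = \tr (Q^T *m D) /\
    forall Q', coupling p q Q' -> \tr (Q^T *m D) <= \tr (Q'^T *m D).
Proof.
move=> pp pq.
pose A : set 'rV[R]_(n * n) := [set v | coupling p q (vec_mx v)].
pose e i j (v : 'rV[R]_(n * n)) : R := v ord0 (mxvec_index i j).
have ce i j : continuous (e i j) by exact: coord_continuous.
have csum (I : finType) (f : I -> 'rV[R]_(n * n) -> R) :
    (forall i, continuous (f i)) -> continuous (fun v => \sum_i f i v).
  by move=> cf; apply: continuous_big => //; exact: add_continuous.
have AE : A = \bigcap_i (fun v => \sum_j e i j v) @^-1` [set p i ord0] `&`
    \bigcap_j (fun v => \sum_i e i j v) @^-1` [set q j ord0] `&`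
    \bigcap_i \bigcap_j e i j @^-1` [set x | 0 <= x].
  apply/seteqP; split => v.
    move=> [vp vq v0]; split; first split.
    - move=> i _ /=; rewrite -vp mxE; apply: eq_bigr => j _.
      by rewrite !mxE mulr1.
    - move=> j _ /=; rewrite -vq mxE; apply: eq_bigr => i _.
      by rewrite !mxE mulr1.
    - by move=> i _ j _ /=; move: (v0 i j); rewrite mxE.
  move=> [[vp vq] v0]; split.
  - apply/matrixP => i k; rewrite ord1 -(vp i I) mxE; apply: eq_bigr => j _.
    by rewrite !mxE mulr1.
  - apply/matrixP => j k; rewrite ord1 -(vq j I) mxE; apply: eq_bigr => i _.
    by rewrite !mxE mulr1.
  - by move=> i j; rewrite mxE; exact: (v0 i I j I).
have clA : closed A.
  rewrite AE; apply: closedI; first apply: closedI.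
  - apply: closed_bigI => i _; apply: preimage_closed; last exact: closed_eq.
    by move=> v _; apply: csum.
  - apply: closed_bigI => j _; apply: preimage_closed; last exact: closed_eq.
    by move=> v _; apply: csum.
  - apply: closed_bigI => i _; apply: closed_bigI => j _.
    by apply: preimage_closed; [move=> v _; exact: ce|exact: closed_ge].
have cA : compact A.
  apply: bounded_closed_compact => //.
  exists 1; split=> // x x1 v Av; apply: (le_trans _ (ltW x1)).
  rewrite /Num.norm/= mx_normrE; apply/bigmax_leP; split=> // -[a k] _ /=.
  rewrite ord1; case/mxvec_indexP: k => i j.
  have [_ _ Q0] := Av; move: (Q0 i j) (coupling_le1 i j pp Av).
  by rewrite mxE => h0 h1; rewrite ger0_norm.
pose f (v : 'rV[R]_(n * n)) : R := \tr ((vec_mx v)^T *m D).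
have cf : continuous f.
  have -> : f = fun v => \sum_j \sum_i e i j v * D i j.
    apply/funext => v; apply: eq_bigr => j _; rewrite mxE.
    by apply: eq_bigr => i _; rewrite !mxE.
  apply: (csum) => j; apply: csum => i v.
  by apply: continuousM; [exact: ce|exact: cst_continuous].
have A0 : A !=set0.
  exists (mxvec (p *m q^T)); rewrite /A/= mxvecK; exact: coupling_prod.
have [c /set_mem Ac fc] := compact_EVT_min A0 cA (continuous_subspaceT cf).
have cmin Q' : coupling p q Q' -> f c <= \tr (Q'^T *m D).
  move=> cQ'; have := fc (mxvec Q'); rewrite /f mxvecK; apply.
  by rewrite inE /A/= mxvecK.
exists (vec_mx c) => //; split=> //.
apply/eqP; rewrite eq_le; apply/andP; split.
  apply: ge_inf; last by exists (vec_mx c).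
  by exists (f c) => _ [Q' cQ' <-]; exact: cmin.
apply: lb_le_inf; first by exists (f c), (vec_mx c).
by move=> _ [Q' cQ' <-]; exact: cmin.
Qed.

End wasserstein.

Definition is_metric {R : realType} {T : Type} (d : T -> T -> R) : Prop :=
  [/\ forall x y, d x y = 0 <-> x = y,
      forall x y, d x y = d y x
    & forall x y z, d x z <= d x y + d y z].

Section labeled_data.
Context {R : realType} {M n : nat}.
Implicit Types (P : probability (M.-tuple R * 'I_n.+1)%type R).
Implicit Types (theta : {set 'I_M}).

Definition features : M.-tuple R * 'I_n.+1 -> M.-tuple R := fst.

Let measurable_features : measurable_fun [set: _] features.
Proof. exact: measurable_fst. Qed.

HB.instance Definition _ :=
  isMeasurableFun.Build _ _ _ _ features measurable_features.

Definition marginal P : probability (M.-tuple R) R := distribution P features.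

Definition subvector theta (x : M.-tuple R) : #|theta|.-tuple R :=
  [tuple tnth x (enum_val i) | i < #|theta|].

Lemma measurable_subvector theta : measurable_fun [set: _] (subvector theta).
Proof.
apply/measurable_fun_tnthP => i.
rewrite (_ : _ \o _ = fun x : M.-tuple R => tnth x (enum_val i)).
  exact: measurable_tnth.
by apply/funext => x /=; rewrite tnth_mktuple.
Qed.

(* [cond_distr P Z k]: under P, the function k is a (regular) conditional
   distribution of the label given the statistic Z of the features, that is
   k z = p(Y | Z(X) = z). It is determined only up to a null set. *)
Record cond_distr P d (T : measurableType d) (Z : M.-tuple R -> T)
    (k : T -> 'cV[R]_n.+1) : Prop := CondDistr {
  cond_distr_prob_vec : forall z, prob_vec (k z) ;
  cond_distr_measurable :
    forall c, measurable_fun [set: T] (fun z => k z c ord0) ;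
  cond_distrE : forall (B : set T) (c : 'I_n.+1), measurable B ->
    P ((Z @^-1` B) `*` [set c]) =
    (\int[marginal P]_(x in Z @^-1` B) (k (Z x) c ord0)%:E)%E }.

(* E_X W[p(X), p'(X)] for X distributed according to mu. *)
Definition expected_wasserstein (mu : probability (M.-tuple R) R)
    (D : 'M[R]_n.+1) (p p' : M.-tuple R -> 'cV[R]_n.+1) : \bar R :=
  'E_mu[fun x => wasserstein D (p x) (p' x)].

Definition is_minimizer (K : nat) (f : {set 'I_M} -> \bar R) theta : Prop :=
  #|theta| = K /\
  forall theta' : {set 'I_M}, #|theta'| = K -> (f theta <= f theta')%E.

End labeled_data.

(* Main.v *)
(* W is a metric, so theta |-> d1 theta and theta |-> d2 theta differ by at most
   E W[p(Y|X), p(Yt|X)] + E W[p(Y|X_theta), p(Yt|X_theta)]. Conditioning on X_theta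
   averages both arguments, and W is jointly convex, so the second term is at most
   the first one (conditional Jensen); hence |d1 - d2| <= 2 eps1 for every theta,
   and comparing the two minimizers costs this twice.

   Jensen's inequality is obtained from the sublinearity and the Lipschitz
   continuity of W on pairs of nonnegative vectors of equal mass: the space is cut
   into finitely many cells on which the kernels oscillate little, and on a cell A
   the integral of W(k1, k2) is close to W(\int_A k1, \int_A k2). *)
Require Import Defs.
From mathcomp Require Import all_boot all_order all_algebra.
From mathcomp Require Import all_classical all_reals all_analysis.
From mathcomp Require Import measurable_realfun ring lra.

Set Implicit Arguments.
Unset Strict Implicit.
Unset Printing Implicit Defensive.

Import Order.TTheory GRing.Theory Num.Theory.
Import numFieldTopology.Exports numFieldNormedType.Exports.

Local Open Scope classical_set_scope.
Local Open Scope ring_scope.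

(** * Optimal transport between nonnegative vectors of equal mass *)

Section transport.
Context {R : realType} {n : nat}.
Implicit Types (p q r : 'cV[R]_n) (Q : 'M[R]_n) (m c : R).

(* Unnormalized: the vectors \int_A k are needed without dividing by mu A. At mass
   1 this is prob_vec. *)
Definition mass_vec m p : Prop :=
  (forall i, 0 <= p i ord0) /\ \sum_i p i ord0 = m.

Lemma couplingP p q Q : coupling p q Q <->
  [/\ forall i, \sum_j Q i j = p i ord0, forall j, \sum_i Q i j = q j ord0
    & forall i j, 0 <= Q i j].
Proof.
have rowE i : (Q *m const_mx 1 : 'cV_n) i ord0 = \sum_j Q i j.
  by rewrite mxE; apply: eq_bigr => j _; rewrite mxE mulr1.
have colE j : (Q^T *m const_mx 1 : 'cV_n) j ord0 = \sum_i Q i j.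
  by rewrite mxE; apply: eq_bigr => i _; rewrite !mxE mulr1.
split=> [[<- <- Q0]|[Qp Qq Q0]]; first by split.
by split=> //; apply/matrixP => i k; rewrite ord1 ?rowE ?colE ?Qp ?Qq.
Qed.

(** The witness is the product coupling divided by the mass. At mass 0 both vectors vanish, and the
    zero matrix that results couples them. *)
Lemma coupling_exists m p q :
  mass_vec m p -> mass_vec m q -> exists Q, coupling p q Q.
Proof.
move=> [p0 pm] [q0 qm]; exists (\matrix_(i, j) (p i ord0 * q j ord0 / m)).
have zero (u : 'cV[R]_n) i : (forall i, 0 <= u i ord0) ->
    \sum_i u i ord0 = m -> m = 0 -> u i ord0 = 0.
  move=> u0 um m0; apply/eqP; rewrite eq_le u0 andbT -m0 -um.
  by rewrite (bigD1 i)//= lerDl sumr_ge0.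
apply/couplingP; split=> [i|j|i j].
- under eq_bigr do rewrite mxE -mulrA mulrCA.
  rewrite -mulr_suml qm; have [m0|m0] := eqVneq m 0; last first.
    by rewrite mulrCA mulfV ?mulr1.
  by rewrite m0 mul0r (zero p).
- under eq_bigr do rewrite mxE -mulrA.
  rewrite -mulr_suml pm; have [m0|m0] := eqVneq m 0; last first.
    by rewrite mulrCA mulfV ?mulr1.
  by rewrite m0 mul0r (zero q).
- by rewrite mxE !mulr_ge0// invr_ge0 -pm sumr_ge0.
Qed.

Variable D : 'M[R]_n.
Hypothesis D_ge0 : forall i j, 0 <= D i j.

Let W := wasserstein D.
Let C := \sum_i \sum_j D i j.

Lemma costE Q : \tr (Q^T *m D) = \sum_i \sum_j Q i j * D i j.
Proof.
rewrite exchange_big; apply: eq_bigr => j _; rewrite mxE.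
by apply: eq_bigr => i _; rewrite mxE.
Qed.

Lemma wasserstein_le p q Q :
  coupling p q Q -> W p q <= \sum_i \sum_j Q i j * D i j.
Proof.
move=> cQ; apply: ge_inf; last by exists Q => //; rewrite costE.
exists 0 => _ [Q' /couplingP[_ _ Q'0] <-]; rewrite costE.
by do 2 apply: sumr_ge0 => ? _; rewrite mulr_ge0.
Qed.

(** Equality of the masses makes the set of couplings nonempty; on the empty set [inf] would be a
    mere default value. *)
Lemma le_wasserstein m p q c : mass_vec m p -> mass_vec m q ->
  (forall Q, coupling p q Q -> c <= \sum_i \sum_j Q i j * D i j) -> c <= W p q.
Proof.
move=> pm qm cle; apply: lb_le_inf.
  by have [Q cQ] := coupling_exists pm qm; exists (\tr (Q^T *m D)), Q.
by move=> _ [Q cQ <-]; rewrite costE; exact: cle.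
Qed.

Lemma wasserstein_ge0 m p q : mass_vec m p -> mass_vec m q -> 0 <= W p q.
Proof.
move=> pm qm; apply: (le_wasserstein pm qm) => Q /couplingP[_ _ Q0].
by do 2 apply: sumr_ge0 => ? _; rewrite mulr_ge0.
Qed.

(** No entry of a coupling exceeds the total mass. *)
Lemma wasserstein_le_mass m p q :
  mass_vec m p -> mass_vec m q -> W p q <= C * m.
Proof.
move=> pm qm; have [Q cQ] := coupling_exists pm qm.
apply: (le_trans (wasserstein_le cQ)); have /couplingP[Qp _ Q0] := cQ.
rewrite mulr_suml; apply: ler_sum => i _.
rewrite mulr_suml; apply: ler_sum => j _; rewrite mulrC ler_wpM2l//.
rewrite -pm.2 (le_trans (y := p i ord0))//.
  by rewrite -Qp (bigD1 j)//= lerDl sumr_ge0.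
by rewrite (bigD1 i)//= lerDl sumr_ge0// => k _; exact: pm.1.
Qed.

Lemma mass_vecD m m' p q :
  mass_vec m p -> mass_vec m' q -> mass_vec (m + m') (p + q).
Proof.
move=> [p0 pm] [q0 qm]; split=> [i|]; first by rewrite mxE addr_ge0.
by rewrite -pm -qm -big_split; apply: eq_bigr => i _; rewrite mxE.
Qed.

Lemma mass_vecZ c m p : 0 <= c -> mass_vec m p -> mass_vec (c * m) (c *: p).
Proof.
move=> c0 [p0 pm]; split=> [i|]; first by rewrite mxE mulr_ge0.
by rewrite -pm mulr_sumr; apply: eq_bigr => i _; rewrite mxE.
Qed.

(** Adding couplings adds marginals and costs. Each distance on the right is isolated in turn, so
    that it can be replaced by the cost of an arbitrary coupling. *)
Lemma wassersteinD m m' p q p' q' :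
  mass_vec m p -> mass_vec m q -> mass_vec m' p' -> mass_vec m' q' ->
  W (p + p') (q + q') <= W p q + W p' q'.
Proof.
move=> pm qm pm' qm'; rewrite -lerBlDr.
apply: (le_wasserstein pm qm) => Q /couplingP[Qp Qq Q0].
rewrite lerBlDr -lerBlDl.
apply: (le_wasserstein pm' qm') => Q' /couplingP[Qp' Qq' Q0'].
rewrite lerBlDl -big_split/=.
have cQ : coupling (p + p') (q + q') (Q + Q').
  apply/couplingP; split=> [i|j|i j].
  - by rewrite mxE -Qp -Qp' -big_split; apply: eq_bigr => j _; rewrite mxE.
  - by rewrite mxE -Qq -Qq' -big_split; apply: eq_bigr => i _; rewrite mxE.
  - by rewrite mxE addr_ge0.
apply: (le_trans (wasserstein_le cQ)); rewrite le_eqVlt; apply/orP; left.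
apply/eqP/eq_bigr => i _; rewrite -big_split; apply: eq_bigr => j _.
by rewrite mxE mulrDl.
Qed.

Let wasserstein_scale_le m c p q : 0 < c -> mass_vec m p -> mass_vec m q ->
  W (c *: p) (c *: q) <= c * W p q.
Proof.
move=> c0 pm qm; rewrite -ler_pdivrMl//.
apply: (le_wasserstein pm qm) => Q /couplingP[Qp Qq Q0].
rewrite ler_pdivrMl//.
have cQ : coupling (c *: p) (c *: q) (c *: Q).
  apply/couplingP; split=> [i|j|i j].
  - by rewrite mxE -Qp mulr_sumr; apply: eq_bigr => j _; rewrite mxE.
  - by rewrite mxE -Qq mulr_sumr; apply: eq_bigr => i _; rewrite mxE.
  - by rewrite mxE mulr_ge0// ltW.
apply: (le_trans (wasserstein_le cQ)); rewrite le_eqVlt; apply/orP; left.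
apply/eqP; rewrite mulr_sumr; apply: eq_bigr => i _.
by rewrite mulr_sumr; apply: eq_bigr => j _; rewrite mxE mulrA.
Qed.

(** The inequality missing from [wasserstein_scale_le] is that lemma for [c^-1] and the scaled
    vectors. At [c = 0] the mass is 0, and so is the cost. *)
Lemma wassersteinZ m c p q : 0 <= c -> mass_vec m p -> mass_vec m q ->
  W (c *: p) (c *: q) = c * W p q.
Proof.
rewrite le_eqVlt => /predU1P[<-|c0] pm qm.
  have m0 u : mass_vec m u -> mass_vec 0 (0 *: u).
    by move=> um; rewrite -[X in mass_vec X](mul0r m); exact: mass_vecZ.
  apply/eqP; rewrite mul0r eq_le (wasserstein_ge0 (m0 _ pm) (m0 _ qm)) andbT.
  by have := wasserstein_le_mass (m0 _ pm) (m0 _ qm); rewrite mulr0.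
apply/eqP; rewrite eq_le (wasserstein_scale_le c0 pm qm)//= -ler_pdivlMl//.
have := wasserstein_scale_le (c := c^-1) _ (mass_vecZ (ltW c0) pm)
  (mass_vecZ (ltW c0) qm).
by rewrite !scalerA mulVf ?gt_eqF// !scale1r invr_gt0; exact.
Qed.

(** A finite form of Jensen's inequality, meant for integrals over the cells of a partition. *)
Lemma wasserstein_sum (I : finType) (m : I -> R) (p q : I -> 'cV[R]_n) :
  (forall i, mass_vec (m i) (p i)) -> (forall i, mass_vec (m i) (q i)) ->
  W (\sum_i p i) (\sum_i q i) <= \sum_i W (p i) (q i).
Proof.
move=> pm qm.
have zero : mass_vec 0 (0 : 'cV[R]_n).
  by split=> [i|]; rewrite ?big1// => *; rewrite mxE.
(* The induction also carries the masses of the partial sums, which [wassersteinD] asks for. *)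
suff [_ _] : [/\ mass_vec (\sum_i m i) (\sum_i p i),
  mass_vec (\sum_i m i) (\sum_i q i) &
  W (\sum_i p i) (\sum_i q i) <= \sum_i W (p i) (q i)] by [].
elim: (index_enum I) => [|i s [ps qs Ws]]; rewrite ?(big_nil, big_cons).
  by split=> //; have := wasserstein_le_mass zero zero; rewrite mulr0.
split; [exact: mass_vecD|exact: mass_vecD|].
by rewrite (le_trans (wassersteinD (pm i) (qm i) ps qs))// lerD2l.
Qed.

Hypothesis D_diag : forall i, D i i = 0.
Hypothesis D_sym : forall i j, D i j = D j i.
Hypothesis D_triangle : forall i j k, D i k <= D i j + D j k.

(** Transposing a coupling exchanges its marginals and, [D] being symmetric, keeps its cost. *)
Lemma wasserstein_sym m p q : mass_vec m p -> mass_vec m q -> W p q = W q p.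
Proof.
suff le u v : mass_vec m u -> mass_vec m v -> W u v <= W v u.
  by move=> pm qm; apply/eqP; rewrite eq_le !le.
move=> um vm; apply: (le_wasserstein vm um) => Q /couplingP[Qv Qu Q0].
have cQ : coupling u v Q^T.
  apply/couplingP; split=> [i|j|i j]; last by rewrite mxE.
  - by rewrite -Qu; apply: eq_bigr => j _; rewrite mxE.
  - by rewrite -Qv; apply: eq_bigr => i _; rewrite mxE.
apply: (le_trans (wasserstein_le cQ)); rewrite exchange_big/=.
by apply: ler_sum => i _; apply: ler_sum => j _; rewrite mxE D_sym.
Qed.

Lemma wasserstein_triangle m p q r :
  mass_vec m p -> mass_vec m q -> mass_vec m r -> W p r <= W p q + W q r.
Proof.
move=> pm qm rm; rewrite -lerBlDr.
apply: (le_wasserstein pm qm) => Q cQ; have /couplingP[Qp Qq Q0] := cQ.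
rewrite lerBlDr -lerBlDl.
apply: (le_wasserstein qm rm) => Q' cQ'; have /couplingP[Qq' Qr Q0'] := cQ'.
rewrite lerBlDl.
(* Conditionally on the middle class j, the outer classes are independent; where
   q j = 0 the j-th column of Q and the j-th row of Q' vanish. *)
pose G i j k := Q i j * Q' j k / q j ord0.
have Gk i j : \sum_k G i j k = Q i j.
  rewrite -mulr_suml -mulr_sumr Qq'; have [q0|q0] := eqVneq (q j ord0) 0.
    rewrite q0 mulr0 mul0r; apply/eqP; rewrite eq_sym eq_le Q0 andbT -q0 -Qq.
    by rewrite (bigD1 i)//= lerDl sumr_ge0.
  by rewrite mulfK.
have Gi j k : \sum_i G i j k = Q' j k.
  rewrite -mulr_suml -mulr_suml Qq; have [q0|q0] := eqVneq (q j ord0) 0.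
    rewrite q0 !mul0r; apply/eqP; rewrite eq_sym eq_le Q0' andbT -q0 -Qq'.
    by rewrite (bigD1 k)//= lerDl sumr_ge0.
  by rewrite mulrC mulKf.
have G0 i j k : 0 <= G i j k.
  by rewrite !mulr_ge0// invr_ge0; exact: qm.1.
have cG : coupling p r (\matrix_(i, k) \sum_j G i j k).
  apply/couplingP; split=> [i|k|i k]; last by rewrite mxE sumr_ge0.
  - under eq_bigr do rewrite mxE.
    by rewrite exchange_big/= -Qp; apply: eq_bigr => j _.
  - under eq_bigr do rewrite mxE.
    by rewrite exchange_big/= -Qr; apply: eq_bigr => j _.
apply: (le_trans (wasserstein_le cG)).
(* Since [Q] and [Q'] are marginals of [G], both costs become sums against [G], and the triangle
   inequality for [D] applies term by term. *)
have -> : \sum_i \sum_j Q i j * D i j + \sum_i \sum_j Q' i j * D i j =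
    \sum_i \sum_k \sum_j G i j k * (D i j + D j k).
  rewrite [RHS](eq_bigr (fun i => \sum_j Q i j * D i j +
      \sum_k \sum_j G i j k * D j k)).
    rewrite big_split/=; congr (_ + _).
    under [RHS]eq_bigr do rewrite exchange_big/=.
    rewrite [RHS]exchange_big/=; apply: eq_bigr => j _.
    rewrite [RHS]exchange_big/=; apply: eq_bigr => k _.
    by rewrite -mulr_suml Gi.
  move=> i _; have -> : \sum_j Q i j * D i j = \sum_k \sum_j G i j k * D i j.
    by rewrite exchange_big/=; apply: eq_bigr => j _; rewrite -mulr_suml Gk.
  rewrite -big_split/=; apply: eq_bigr => k _.
  by rewrite -big_split/=; apply: eq_bigr => j _; rewrite mulrDr.
apply: ler_sum => i _; apply: ler_sum => k _; rewrite mxE mulr_suml.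
by apply: ler_sum => j _; rewrite ler_wpM2l.
Qed.

Lemma wasserstein_refl m p : mass_vec m p -> W p p = 0.
Proof.
move=> pm; apply/eqP; rewrite eq_le (wasserstein_ge0 pm pm) andbT.
have cQ : coupling p p (\matrix_(i, j) (p i ord0 *+ (i == j))).
  apply/couplingP; split=> [i|j|i j].
  - rewrite (bigD1 i)//= mxE eqxx big1 ?addr0// => j ji.
    by rewrite mxE eq_sym (negbTE ji) mulr0n.
  - rewrite (bigD1 j)//= mxE eqxx big1 ?addr0// => i ij.
    by rewrite mxE (negbTE ij) mulr0n.
  - by rewrite mxE mulrn_wge0//; exact: pm.1.
apply: (le_trans (wasserstein_le cQ)); rewrite big1// => i _.
rewrite big1// => j _.
by rewrite mxE; case: eqVneq => [->|_]; rewrite ?D_diag ?mulr0// mul0r.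
Qed.

(* The common part of p and q is left in place, at no cost. *)
Lemma wasserstein_le_variation m p q : mass_vec m p -> mass_vec m q ->
  W p q <= C * \sum_i `|p i ord0 - q i ord0|.
Proof.
move=> [p0 pm] [q0 qm].
pose c : 'cV[R]_n := \col_i Num.min (p i ord0) (q i ord0).
pose l := \sum_i c i ord0.
have cl : mass_vec l c by split=> // i; rewrite mxE le_min p0 q0.
have rest (u : 'cV[R]_n) : (forall i, c i ord0 <= u i ord0) ->
    \sum_i u i ord0 = m -> mass_vec (m - l) (u - c).
  move=> cu um; split=> [i|]; first by have := cu i; rewrite !mxE subr_ge0.
  by rewrite -um -sumrB; apply: eq_bigr => i _; rewrite !mxE.
have rp : mass_vec (m - l) (p - c).
  by apply: rest => // i; rewrite mxE ge_min lexx.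
have rq : mass_vec (m - l) (q - c).
  by apply: rest => // i; rewrite mxE ge_min lexx orbT.
have := wassersteinD cl cl rp rq.
rewrite !(addrC c) !subrK (wasserstein_refl cl) add0r.
move=> /le_trans; apply; apply: (le_trans (wasserstein_le_mass rp rq)).
rewrite ler_wpM2l//; first by do 2 apply: sumr_ge0 => ? _.
(* The mass [m - l] left to move is the sum of the positive parts of [p - q]. *)
rewrite -pm -sumrB; apply: ler_sum => i _; rewrite mxE.
have [pq|qp] := leP (p i ord0) (q i ord0); first by rewrite subrr.
exact: ler_norm.
Qed.

(** Go from [p] to [q] through [p'] and [q']; the variation bounds the first and the last leg. *)
Lemma wasserstein_lipschitz m p q p' q' :
  mass_vec m p -> mass_vec m q -> mass_vec m p' -> mass_vec m q' ->
  W p q - W p' q' <=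
  C * (\sum_i `|p i ord0 - p' i ord0| + \sum_i `|q i ord0 - q' i ord0|).
Proof.
move=> pm qm pm' qm'; rewrite mulrDr lerBlDr.
rewrite (le_trans (wasserstein_triangle pm pm' qm))// -addrA lerD//.
  exact: wasserstein_le_variation pm pm'.
rewrite (le_trans (wasserstein_triangle pm' qm' qm))// addrC lerD2l.
rewrite (wasserstein_sym qm' qm); exact: wasserstein_le_variation qm qm'.
Qed.

End transport.

(** * Finite measurable partitions on which given functions oscillate little *)

Section finite_level_partitions.
Context {d} {T : measurableType d} {R : realType}.
Implicit Types (f : T -> R) (e : R).

(** A finite partition is encoded by its labelling map [c]; the cells are the fibres, and some of
    them may be empty. *)
Definition measurable_cells (J : finType) (c : T -> J) : Prop :=
  forall j, measurable (c @^-1` [set j]).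

(** A point is labelled by the integer parts of all [N%:R * f i x], where [1/N <= e]: equal labels
    put the values of each [f i] in a common interval of length [1/N]. *)
Lemma measurable_level (I : finType) (f : I -> T -> R) e : 0 < e ->
  (forall i x, 0 <= f i x <= 1) -> (forall i, measurable_fun setT (f i)) ->
  exists (J : finType) (c : T -> J), measurable_cells c /\
    forall x y, c x = c y -> forall i, `|f i x - f i y| <= e.
Proof.
move=> e0 f01 mf; pose N := (Num.truncn e^-1).+1.
have N0 : 0 < N%:R :> R by rewrite ltr0n.
have Ne : N%:R^-1 <= e.
  by rewrite invf_ple ?posrE//; exact/ltW/truncnS_gt.
have Nf0 i x : 0 <= N%:R * f i x.
  by rewrite mulr_ge0//; case/andP: (f01 i x).
(* The value 1 of [f i] receives the label [N], hence [N.+1] labels. *)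
have Nf_lt i x : (Num.truncn (N%:R * f i x) < N.+1)%N.
  rewrite truncn_lt_nat// (le_lt_trans (y := N%:R)) ?ltr_nat//.
  by rewrite ger_pMr//; case/andP: (f01 i x).
pose c x : {ffun I -> 'I_N.+1} := [ffun i => Ordinal (Nf_lt i x)].
exists {ffun I -> 'I_N.+1}, c; split=> [j|x y cxy i].
  have -> : c @^-1` [set j] = \bigcap_(i in [set: I])
      ((fun x => N%:R * f i x) @^-1` [set y | (j i)%:R <= y < (j i).+1%:R]).
    apply/seteqP; split=> [x /= <- i _ /=|x cx /=].
      by rewrite ffunE /= truncn_itv.
    apply/ffunP => i; apply/val_inj; rewrite ffunE/=; apply/eqP.
    by rewrite truncn_eq//; exact: (cx i Logic.I).
  apply: fin_bigcap_measurable => [|i _]; first exact: finite_finset.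
  rewrite -[X in measurable X]setTI.
  have mNf : measurable_fun setT (fun x => N%:R * f i x).
    exact: measurable_funM.
  rewrite (_ : [set y | _] = `[(j i)%:R, (j i).+1%:R[%classic).
    by apply: mNf.
  by apply/seteqP; split=> y /=; rewrite in_itv.
have /(congr1 (@nat_of_ord _)) : c x i = c y i by rewrite cxy.
rewrite !ffunE/= => Nxy; apply: le_trans Ne.
rewrite -(ler_pM2l N0) divff ?gt_eqF//.
rewrite -[X in X * `|_|]gtr0_norm// -normrM mulrBr.
have := truncn_itv (Nf0 i x); have := truncn_itv (Nf0 i y).
rewrite Nxy -natr1 => /andP[y1 y2] /andP[x1 x2].
by rewrite ler_norml; apply/andP; split; lra.
Qed.

Lemma measurable_fun_cells (J : finType) (c : T -> J) (h : J -> R) :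
  measurable_cells c -> measurable_fun setT (h \o c).
Proof.
move=> mc _ Y mY; rewrite setTI.
rewrite (_ : _ @^-1` _ = \bigcup_(j in [set j | Y (h j)]) (c @^-1` [set j])).
  by apply: fin_bigcup_measurable => // ; exact: finite_finset.
apply/seteqP; split=> [x Yx|x [j /[swap] /= <-]] //; by exists (c x).
Qed.

(** Choosing one value per cell gives measurable step functions that converge uniformly to [f]. *)
Lemma measurable_fun_level f :
  (forall e, 0 < e -> exists (J : finType) (c : T -> J), measurable_cells c /\
    forall x y, c x = c y -> `|f x - f y| <= e) ->
  measurable_fun setT f.
Proof.
move=> fP.
have /choice[g gP] (N : nat) : exists g : T -> R, measurable_fun setT g /\
    forall x, `|f x - g x| <= N.+1%:R^-1.
  have [|J [c [mc cP]]] := fP N.+1%:R^-1; first by rewrite invr_gt0.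
  have /choice[h hP] j : exists r, forall x, c x = j ->
      `|f x - r| <= N.+1%:R^-1.
    have [[x0 <-]|cj] := pselect (exists x, c x = j).
      by exists (f x0) => x /cP.
    (* On an empty cell any value will do. *)
    by exists 0 => x cx; case: cj; exists x.
  exists (h \o c); split=> [|x /=]; first exact: measurable_fun_cells.
  exact: hP.
apply: (@measurable_fun_cvg _ _ _ _ g) => [N|x _]; first by case: (gP N).
apply/cvgrPdist_le => e e0; near=> N.
apply: le_trans ((gP N).2 x) _; apply: ltW; near: N.
exact: (near_infty_natSinv_lt (PosNum e0)).
Unshelve. all: by end_near. Qed.

End finite_level_partitions.

(** * Integrals of bounded functions and their decomposition over cells *)

Section bounded_integrals.
Context {d} {T : measurableType d} {R : realType} (mu : probability T R).
Implicit Types (A : set T) (f : T -> R).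

Lemma integrable_bounded A f b : measurable A -> measurable_fun setT f ->
  (forall x, 0 <= f x <= b) -> mu.-integrable A (EFin \o f).
Proof.
move=> mA mf fb; apply: measurable_bounded_integrable => //.
- by rewrite (le_lt_trans (probability_le1 mu mA))// ltry.
- exact: measurable_funTS.
- exists b; split=> [|B bB x _ /=]; first exact: num_real.
  have /andP[f0 fb'] := fb x; rewrite ger0_norm//.
  exact: le_trans fb' (ltW bB).
Qed.

Lemma EFin_Rintegral A f : mu.-integrable A (EFin \o f) -> measurable A ->
  (\int[mu]_(x in A) f x)%:E = (\int[mu]_(x in A) (f x)%:E)%E.
Proof.
by move=> fi mA; rewrite /Rintegral fineK//; exact: integrable_fin_num.
Qed.

Lemma Rintegral_cells (J : finType) (c : T -> J) A f b :
  measurable_cells c -> measurable A -> measurable_fun setT f ->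
  (forall x, 0 <= f x <= b) ->
  \int[mu]_(x in A) f x = \sum_j \int[mu]_(x in A `&` c @^-1` [set j]) f x.
Proof.
move=> mc mA mf fb; have mAc j : measurable (A `&` c @^-1` [set j]).
  exact: measurableI.
have fi B : measurable B -> mu.-integrable B (EFin \o f).
  by move=> mB; exact: integrable_bounded fb.
apply: EFin_inj; rewrite -sumEFin EFin_Rintegral//; last exact: fi.
under [RHS]eq_bigr do rewrite (EFin_Rintegral (fi _ (mAc _)) (mAc _)).
have AE : A = \big[setU/set0]_(j <- index_enum J) (A `&` c @^-1` [set j]).
  rewrite -bigcup_seq; apply/seteqP; split=> [x Ax|x [j _ []]]//.
  by exists (c x) => //=; rewrite mem_index_enum.
rewrite {1}AE ge0_integral_bigsetU//.
- exact: index_enum_uniq.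
- by move=> i j _ _ [x [[_ /= <-] [_ /= <-]]].
- by apply/measurable_EFinP; exact: measurable_funTS.
- by move=> x _; rewrite lee_fin; case/andP: (fb x).
Qed.

(** The measure is the integral of the constant 1, to which [Rintegral_cells] applies. *)
Lemma measure_cells (J : finType) (c : T -> J) A :
  measurable_cells c -> measurable A ->
  fine (mu A) = \sum_j fine (mu (A `&` c @^-1` [set j])).
Proof.
move=> mc mA.
have cstE B : measurable B -> fine (mu B) = \int[mu]_(x in B) (cst 1 x : R).
  by move=> mB; rewrite Rintegral_cst// mul1r.
rewrite cstE// (Rintegral_cells mc mA (b := 1))//; last first.
  by move=> x; rewrite ler01/=.
by apply: eq_bigr => j _; rewrite cstE//; exact: measurableI.
Qed.

(** The error is proportional to the measure of [A], so that errors on the cells of a partition add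
    up to at most [e]. *)
Lemma Rintegral_near_cst A f b a e : measurable A -> measurable_fun setT f ->
  (forall x, 0 <= f x <= b) -> (forall x, A x -> `|f x - a| <= e) ->
  `|\int[mu]_(x in A) f x - fine (mu A) * a| <= fine (mu A) * e.
Proof.
move=> mA mf fb fa.
have fi : mu.-integrable A (EFin \o f) by exact: integrable_bounded fb.
have ci r : mu.-integrable A (EFin \o cst r).
  exact: finite_measure_integrable_cst.
rewrite -(mulrC a) -(mulrC e) -!Rintegral_cst// -RintegralB//; last exact: ci.
have fai : mu.-integrable A (EFin \o (fun x => f x - a)).
  exact: (integrableB mA fi (ci a)).
apply: (le_trans (le_normr_Rintegral mA fai)).
by apply: le_Rintegral => //; [exact: (integrable_norm fai)|exact: ci].
Qed.

End bounded_integrals.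

(** * Measurable families of probability vectors *)

Definition prob_kernel {R : realType} {n : nat} d (T : measurableType d)
    (k : T -> 'cV[R]_n) : Prop :=
  (forall x, prob_vec (k x)) /\
  (forall i, measurable_fun setT (fun x => k x i ord0)).

Section prob_kernels.
Context {R : realType} {n : nat} {d} {T : measurableType d}.
Implicit Types (k : T -> 'cV[R]_n) (e : R).

Lemma prob_kernel01 k x i : prob_kernel k -> 0 <= k x i ord0 <= 1.
Proof.
case=> /(_ x)[k0 k1] _; rewrite k0/= -k1 (bigD1 i)//= lerDl.
by apply: sumr_ge0 => j _; exact: k0.
Qed.

Lemma prob_kernel_level k1 k2 e : prob_kernel k1 -> prob_kernel k2 -> 0 < e ->
  exists (J : finType) (c : T -> J), measurable_cells c /\
    forall x y, c x = c y -> forall i,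
      `|k1 x i ord0 - k1 y i ord0| <= e /\ `|k2 x i ord0 - k2 y i ord0| <= e.
Proof.
move=> kk1 kk2 e0.
(* The coordinates of both kernels form a single family, so that one partition serves both. *)
pose f (s : 'I_n + 'I_n) x :=
  match s with inl i => k1 x i ord0 | inr i => k2 x i ord0 end.
have [|s|J [c [mc cP]]] := measurable_level (f := f) e0.
- move=> [i|i] x.
    exact: (prob_kernel01 x i kk1).
  exact: (prob_kernel01 x i kk2).
- by case: s => i; [exact: kk1.2|exact: kk2.2].
exists J, c; split=> // x y cxy i.
by split; [exact: (cP _ _ cxy (inl i))|exact: (cP _ _ cxy (inr i))].
Qed.

Lemma prob_kernel_comp d' (T' : measurableType d') (Z : T -> T')
    (h : T' -> 'cV[R]_n) :
  measurable_fun setT Z -> prob_kernel h -> prob_kernel (h \o Z).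
Proof.
move=> mZ [hP mh]; split=> [x|i]; first exact: hP.
exact: (measurableT_comp (mh i) mZ).
Qed.

End prob_kernels.

(** * Expected transport cost and the conditional Jensen inequality *)

Section expected_transport.
Context {d} {T : measurableType d} {R : realType} (mu : probability T R).
Context {n : nat} (D : 'M[R]_n).
Hypothesis D_ge0 : forall i j, 0 <= D i j.
Hypothesis D_diag : forall i, D i i = 0.
Hypothesis D_sym : forall i j, D i j = D j i.
Hypothesis D_triangle : forall i j k, D i k <= D i j + D j k.
Implicit Types (A : set T) (k : T -> 'cV[R]_n) (e : R).

Let W := wasserstein D.
Let C := \sum_i \sum_j D i j.
(** The Lipschitz bound on the change of [W] when every coordinate of both arguments moves by at
    most [e]. *)
Let K e := C * (n%:R * e + n%:R * e).

Definition vec_integral A k : 'cV[R]_n :=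
  \col_i \int[mu]_(x in A) k x i ord0.

(** The coordinates of a kernel sum to 1 pointwise. Hence the integrals of two kernels over [A] have
    equal mass and can be compared by [W]. *)
Lemma mass_vec_integral k A : prob_kernel k -> measurable A ->
  mass_vec (fine (mu A)) (vec_integral A k).
Proof.
move=> kk mA; split=> [i|].
  by rewrite mxE Rintegral_ge0// => x _; case/andP: (prob_kernel01 x i kk).
have ki i : mu.-integrable A (EFin \o (fun x => k x i ord0)).
  apply: (integrable_bounded mu mA (kk.2 i) (b := 1)) => x.
  exact: (prob_kernel01 x i kk).
apply: EFin_inj; rewrite -sumEFin fineK; last exact: fin_num_measure.
under eq_bigr do rewrite mxE (EFin_Rintegral (ki _) mA).
rewrite -ge0_integral_sum//; first last.
- by move=> i x _; rewrite lee_fin; case/andP: (prob_kernel01 x i kk).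
- by move=> i; apply/measurable_EFinP; exact: measurable_funTS (kk.2 i).
rewrite (eq_integral (cst 1%E)); first by rewrite integral_cst// mul1e.
by move=> x _; rewrite sumEFin (kk.1 x).2.
Qed.

Lemma vec_integral_cells (J : finType) (c : T -> J) k A : prob_kernel k ->
  measurable_cells c -> measurable A ->
  vec_integral A k = \sum_j vec_integral (A `&` c @^-1` [set j]) k.
Proof.
move=> kk mc mA; apply/matrixP => i z; rewrite mxE summxE.
rewrite (Rintegral_cells mu mc mA (kk.2 i) (b := 1)); last first.
  by move=> x; exact: (prob_kernel01 x i kk).
by apply: eq_bigr => j _; rewrite mxE.
Qed.

Let C_ge0 : 0 <= C.
Proof. by do 2 apply: sumr_ge0 => ? _. Qed.

Let K_small e : 0 < e -> exists2 e', 0 < e' & K e' <= e.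
Proof.
move=> e0; have K1 : 0 <= K 1 by rewrite mulr_ge0// addr_ge0// mulr1.
(* [K] is linear; the added 1 covers the case [K 1 = 0]. *)
exists (e / (K 1 + 1)); first by rewrite divr_gt0// ltr_wpDl.
rewrite (_ : K _ = e * (K 1 / (K 1 + 1))); last by rewrite /K; ring.
by rewrite ger_pMr// ler_pdivrMr ?ltr_wpDl// mul1r lerDl.
Qed.

Let wasserstein_close m (p q p' q' : 'cV[R]_n) e :
  mass_vec m p -> mass_vec m q -> mass_vec m p' -> mass_vec m q' ->
  (forall i, `|p i ord0 - p' i ord0| <= e) ->
  (forall i, `|q i ord0 - q' i ord0| <= e) ->
  `|W p q - W p' q'| <= K e.
Proof.
move=> pm qm pm' qm' pe qe.
have sum_le (f : 'I_n -> R) : (forall i, f i <= e) -> \sum_i f i <= n%:R * e.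
  move=> fe; rewrite (le_trans (ler_sum _ (fun i _ => fe i)))//.
  by rewrite sumr_const card_ord mulr_natl.
have lip := wasserstein_lipschitz D_ge0 D_diag D_sym D_triangle.
rewrite ler_norml; apply/andP; split; last first.
  rewrite (le_trans (lip _ _ _ _ _ pm qm pm' qm'))// ler_wpM2l//.
  by rewrite lerD// sum_le.
rewrite lerNl opprB (le_trans (lip _ _ _ _ _ pm' qm' pm qm))// ler_wpM2l//.
by rewrite lerD// sum_le// => i; rewrite distrC.
Qed.

Lemma wasserstein_kernel_bound k1 k2 x : prob_kernel k1 -> prob_kernel k2 ->
  0 <= W (k1 x) (k2 x) <= C.
Proof.
move=> [k1P _] [k2P _]; rewrite (wasserstein_ge0 D_ge0 (k1P x) (k2P x))/=.
by have := wasserstein_le_mass D_ge0 (k1P x) (k2P x); rewrite mulr1.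
Qed.

(** By Lipschitz continuity the distance oscillates little on each cell where both kernels do, so
    [measurable_fun_level] applies. *)
Lemma measurable_wasserstein k1 k2 : prob_kernel k1 -> prob_kernel k2 ->
  measurable_fun setT (fun x => W (k1 x) (k2 x)).
Proof.
move=> kk1 kk2; apply: measurable_fun_level => e /K_small[e' e'0 Ke'].
have [J [c [mc cP]]] := prob_kernel_level kk1 kk2 e'0.
exists J, c; split=> // x y /cP cxy; apply: le_trans Ke'.
by apply: (wasserstein_close (kk1.1 x) (kk2.1 x) (kk1.1 y) (kk2.1 y)) => i;
  case: (cxy i).
Qed.

Lemma integrable_wasserstein k1 k2 A : prob_kernel k1 -> prob_kernel k2 ->
  measurable A -> mu.-integrable A (EFin \o (fun x => W (k1 x) (k2 x))).
Proof.
move=> kk1 kk2 mA.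
apply: (integrable_bounded mu mA (measurable_wasserstein kk1 kk2)
  (b := C)) => x.
exact: wasserstein_kernel_bound.
Qed.

(** Both terms are compared with [m * W (k1 x0) (k2 x0)] for a point [x0] of [A]. By homogeneity
    this is also the distance between the vectors [m *: k1 x0] and [m *: k2 x0], which are within
    [m * e] of the integrals in each coordinate. Each comparison costs [m * K e]. *)
Let wasserstein_cell k1 k2 A e : prob_kernel k1 -> prob_kernel k2 ->
  measurable A ->
  (forall x y, A x -> A y -> forall i,
    `|k1 x i ord0 - k1 y i ord0| <= e /\ `|k2 x i ord0 - k2 y i ord0| <= e) ->
  `|\int[mu]_(x in A) W (k1 x) (k2 x) -
    W (vec_integral A k1) (vec_integral A k2)| <= fine (mu A) * (K e *+ 2).
Proof.
move=> kk1 kk2 mA osc; set m := fine (mu A).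
have m0 : 0 <= m by rewrite fine_ge0.
have M1 := mass_vec_integral kk1 mA; have M2 := mass_vec_integral kk2 mA.
have [[x0 Ax0]|A0] := pselect (A !=set0); last first.
  have {A0} A0 : A = set0 by apply/seteqP; split=> // x Ax; apply: A0; exists x.
  rewrite /m A0 measure0/= Rintegral_set0 sub0r normrN mul0r.
  have zero k : vec_integral set0 k = 0.
    by apply/matrixP => i j; rewrite !mxE Rintegral_set0.
  have W0 : W 0 0 = 0.
    apply: (wasserstein_refl D_ge0 D_diag (m := 0)).
    by split=> [i|]; rewrite ?big1// => *; rewrite mxE.
  by rewrite !zero W0 normr0.
have near1 : `|\int[mu]_(x in A) W (k1 x) (k2 x) - m * W (k1 x0) (k2 x0)|
    <= m * K e.
  apply: (Rintegral_near_cst mu mA (measurable_wasserstein kk1 kk2) (b := C)).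
    by move=> x; exact: wasserstein_kernel_bound.
  move=> x Ax; apply: (wasserstein_close (kk1.1 x) (kk2.1 x) (kk1.1 x0)
    (kk2.1 x0)) => i; by case: (osc x x0 Ax Ax0 i).
have near2 : `|m * W (k1 x0) (k2 x0) -
    W (vec_integral A k1) (vec_integral A k2)| <= m * K e.
  have scale k : prob_kernel k -> mass_vec m (m *: k x0).
    move=> [kP _]; rewrite -[X in mass_vec X]mulr1.
    by apply: mass_vecZ => //; exact: kP.
  rewrite -(wassersteinZ D_ge0 m0 (kk1.1 x0) (kk2.1 x0)) distrC.
  rewrite (_ : m * K e = K (m * e)); last by rewrite /K; ring.
  apply: (wasserstein_close M1 M2 (scale _ kk1) (scale _ kk2)) => i;
    rewrite !mxE.
  - apply: (Rintegral_near_cst mu mA (kk1.2 i) (b := 1)) => x.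
      exact: (prob_kernel01 x i kk1).
    by move=> Ax; case: (osc x x0 Ax Ax0 i).
  - apply: (Rintegral_near_cst mu mA (kk2.2 i) (b := 1)) => x.
      exact: (prob_kernel01 x i kk2).
    by move=> Ax; case: (osc x x0 Ax Ax0 i).
rewrite mulrnAr mulr2n.
exact: le_trans (ler_distD (m * W (k1 x0) (k2 x0)) _ _) (lerD near1 near2).
Qed.

Let wasserstein_cells d' (T' : measurableType d') (Z : T -> T')
    (h1 h2 : T' -> 'cV[R]_n) e :
  measurable_fun setT Z -> prob_kernel h1 -> prob_kernel h2 -> 0 < e ->
  exists (J : finType) (c : T' -> J), measurable_cells c /\
    forall A j, measurable A -> A `<=` (c \o Z) @^-1` [set j] ->
    `|\int[mu]_(x in A) W (h1 (Z x)) (h2 (Z x)) -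
      W (vec_integral A (h1 \o Z)) (vec_integral A (h2 \o Z))| <=
    fine (mu A) * e.
Proof.
move=> mZ hh1 hh2 e0.
(* Half of [e], as [wasserstein_cell] loses [K e'] twice. *)
have [|e' e'0 Ke'] := @K_small (e / 2); first exact: divr_gt0.
have [J [c [mc cP]]] := prob_kernel_level hh1 hh2 e'0.
exists J, c; split=> // A j mA Aj.
apply: le_trans (wasserstein_cell (prob_kernel_comp mZ hh1)
  (prob_kernel_comp mZ hh2) mA (e := e') _) _.
  by move=> x y /Aj/= cx /Aj/= cy; apply: cP; rewrite cx cy.
by rewrite ler_wpM2l ?fine_ge0// -[leLHS]mulr_natr -ler_pdivlMr.
Qed.

(** Jensen's inequality without normalization: [wasserstein_sum] splits the left side over fine
    cells of [A], and on each cell the distance of the integrals is replaced by the integral of the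
    distance, with total error at most [e]. *)
Lemma wasserstein_vec_integral_le k1 k2 A :
  prob_kernel k1 -> prob_kernel k2 -> measurable A ->
  W (vec_integral A k1) (vec_integral A k2) <=
  \int[mu]_(x in A) W (k1 x) (k2 x).
Proof.
move=> kk1 kk2 mA; apply/ler_addgt0Pr => e e0.
have [J [c [mc cP]]] := wasserstein_cells (@measurable_id _ T setT) kk1 kk2 e0.
have mAc j : measurable (A `&` c @^-1` [set j]) by exact: measurableI.
have bnd x := wasserstein_kernel_bound x kk1 kk2.
rewrite (vec_integral_cells kk1 mc mA) (vec_integral_cells kk2 mc mA).
rewrite (Rintegral_cells mu mc mA (measurable_wasserstein kk1 kk2) bnd).
apply: le_trans (wasserstein_sum D_ge0
  (fun j => mass_vec_integral kk1 (mAc j))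
  (fun j => mass_vec_integral kk2 (mAc j))) _.
have muA : fine (mu A) <= 1.
  by rewrite -lee_fin fineK ?probability_le1// fin_num_measure.
apply: (@le_trans _ _ (\sum_j (\int[mu]_(x in A `&` c @^-1` [set j])
    W (k1 x) (k2 x) + fine (mu (A `&` c @^-1` [set j])) * e))).
  apply: ler_sum => j _; rewrite -lerBlDl.
  apply: le_trans (cP _ j (mAc j) _); last by move=> x [].
  by rewrite distrC ler_norm.
rewrite big_split/= lerD2l -mulr_suml -measure_cells//.
by rewrite ger_pMl.
Qed.

(* On a cell of Z on which the conditioned kernels are nearly constant, they can
   be replaced by their integrals, which are those of the original kernels. *)
Lemma wasserstein_conditioning_le d' (T' : measurableType d') (Z : T -> T')
    k1 k2 (h1 h2 : T' -> 'cV[R]_n) :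
  measurable_fun setT Z ->
  prob_kernel k1 -> prob_kernel k2 -> prob_kernel h1 -> prob_kernel h2 ->
  (forall B, measurable B ->
    vec_integral (Z @^-1` B) (h1 \o Z) = vec_integral (Z @^-1` B) k1) ->
  (forall B, measurable B ->
    vec_integral (Z @^-1` B) (h2 \o Z) = vec_integral (Z @^-1` B) k2) ->
  \int[mu]_x W (h1 (Z x)) (h2 (Z x)) <= \int[mu]_x W (k1 x) (k2 x).
Proof.
move=> mZ kk1 kk2 hh1 hh2 hk1 hk2; apply/ler_addgt0Pr => e e0.
have [J [c [mc cP]]] := wasserstein_cells mZ hh1 hh2 e0.
have hZ1 := prob_kernel_comp mZ hh1; have hZ2 := prob_kernel_comp mZ hh2.
have mcZ : measurable_cells (c \o Z).
  move=> j; rewrite -[X in measurable X]setTI.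
  exact: (mZ measurableT _ (mc j)).
rewrite (Rintegral_cells mu mcZ measurableT (measurable_wasserstein hZ1 hZ2)
  (fun x => wasserstein_kernel_bound x hZ1 hZ2)).
rewrite (Rintegral_cells mu mcZ measurableT (measurable_wasserstein kk1 kk2)
  (fun x => wasserstein_kernel_bound x kk1 kk2)).
(* The error is shared among the cells in proportion to their probability, which reduces the claim
   to a single cell. *)
have -> : e = \sum_j fine (mu (setT `&` (c \o Z) @^-1` [set j])) * e.
  by rewrite -mulr_suml -measure_cells// probability_setT mul1r.
rewrite -big_split/=; apply: ler_sum => j _; rewrite setTI.
have mj : measurable ((c \o Z) @^-1` [set j]) by exact: mcZ.
apply: (@le_trans _ _ (W (vec_integral ((c \o Z) @^-1` [set j]) k1)
  (vec_integral ((c \o Z) @^-1` [set j]) k2) +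
  fine (mu ((c \o Z) @^-1` [set j])) * e)); last first.
  by rewrite lerD2r; exact: wasserstein_vec_integral_le.
rewrite -(hk1 _ (mc j)) -(hk2 _ (mc j)) -lerBlDl.
by apply: le_trans (ler_norm _) (cP _ j mj _).
Qed.

Lemma Rintegral_wasserstein_sym k1 k2 : prob_kernel k1 -> prob_kernel k2 ->
  \int[mu]_x W (k1 x) (k2 x) = \int[mu]_x W (k2 x) (k1 x).
Proof.
move=> [k1P _] [k2P _]; apply: eq_Rintegral => x _.
exact: (wasserstein_sym D_ge0 D_sym (k1P x) (k2P x)).
Qed.

Lemma Rintegral_wasserstein_triangle k1 k2 k3 :
  prob_kernel k1 -> prob_kernel k2 -> prob_kernel k3 ->
  \int[mu]_x W (k1 x) (k3 x) <=
  \int[mu]_x W (k1 x) (k2 x) + \int[mu]_x W (k2 x) (k3 x).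
Proof.
move=> kk1 kk2 kk3.
have i12 := integrable_wasserstein kk1 kk2 measurableT.
have i23 := integrable_wasserstein kk2 kk3 measurableT.
rewrite -RintegralD//; apply: le_Rintegral => //.
- exact: integrable_wasserstein.
- exact: (integrableD measurableT i12 i23).
- move=> x _; exact: (wasserstein_triangle D_ge0 D_triangle
    (kk1.1 x) (kk2.1 x) (kk3.1 x)).
Qed.

End expected_transport.

(** * Integrals of conditional distributions of the label *)

Section conditional_distributions.
Context {R : realType} {M n : nat}.
Implicit Types P Pt : probability (M.-tuple R * 'I_n.+1)%type R.

Lemma cond_distr_kernel P d (T : measurableType d) (Z : M.-tuple R -> T) k :
  cond_distr P Z k -> prob_kernel k.
Proof. by case. Qed.

Lemma cond_distr_vec_integral P d (T : measurableType d)
    (Z : M.-tuple R -> T) k (B : set T) : cond_distr P Z k -> measurable B ->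
  vec_integral (marginal P) (Z @^-1` B) (k \o Z) =
  \col_c fine (P ((Z @^-1` B) `*` [set c])).
Proof.
move=> Zk mB; apply/matrixP => c j; rewrite !mxE /Rintegral.
by rewrite (cond_distrE Zk).
Qed.

Lemma cond_distr_tower P d (T : measurableType d) (Z : M.-tuple R -> T) k
    (p : M.-tuple R -> 'cV[R]_n.+1) (B : set T) :
  measurable_fun setT Z -> cond_distr P id p -> cond_distr P Z k ->
  measurable B ->
  vec_integral (marginal P) (Z @^-1` B) (k \o Z) =
  vec_integral (marginal P) (Z @^-1` B) p.
Proof.
move=> mZ pP kP mB; rewrite (cond_distr_vec_integral kP mB).
have mZB : measurable (Z @^-1` B).
  by rewrite -[X in measurable X]setTI; exact: mZ.
by rewrite -(cond_distr_vec_integral pP mZB).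
Qed.

(** Noisy conditional distributions are characterized by integrals under [marginal Pt], whereas the
    expectations are taken under [marginal P]. *)
Lemma eq_vec_integral P Pt A (k : M.-tuple R -> 'cV[R]_n.+1) :
  (forall A : set (M.-tuple R), measurable A -> marginal P A = marginal Pt A) ->
  vec_integral (marginal P) A k = vec_integral (marginal Pt) A k.
Proof.
move=> same; apply/matrixP => c j; rewrite !mxE; congr fine.
by apply: eq_measure_integral => B mB _; exact: same.
Qed.

End conditional_distributions.

(** * Comparison of the clean and the noisy minimizer *)

Theorem theorem2 (R : realType) (M n : nat)
    (P Pt : probability (M.-tuple R * 'I_n.+1)%type R)
    (same_marginal : forall A : set (M.-tuple R), measurable A ->
       marginal P A = marginal Pt A)
    (d : 'I_n.+1 -> 'I_n.+1 -> R) (d_metric : is_metric d)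
    (p pt : M.-tuple R -> 'cV[R]_n.+1)
    (p_sub pt_sub :
       forall theta : {set 'I_M}, #|theta|.-tuple R -> 'cV[R]_n.+1)
    (p_cond : cond_distr P id p)
    (pt_cond : cond_distr Pt id pt)
    (p_sub_cond : forall theta : {set 'I_M},
       cond_distr P (subvector theta) (p_sub theta))
    (pt_sub_cond : forall theta : {set 'I_M},
       cond_distr Pt (subvector theta) (pt_sub theta))
    (K : nat) (K_le_M : (K <= M)%N) :
  let D : 'M[R]_n.+1 := \matrix_(i, j) d i j in
  let EW := expected_wasserstein (marginal P) D in
  let d1 (theta : {set 'I_M}) := EW p (p_sub theta \o subvector theta) in
  let d2 (theta : {set 'I_M}) := EW pt (pt_sub theta \o subvector theta) in
  let eps1 := EW p pt in
  forall theta1 theta2 : {set 'I_M},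
    is_minimizer K d1 theta1 -> is_minimizer K d2 theta2 ->
    (d1 theta2 - d1 theta1 <= 4%:E * eps1)%E.
Proof.
move=> D EW d1 d2 eps1 theta1 theta2 [c1 _] [c2 min2].
have [d0 dsym dtri] := d_metric.
(* The triangle inequality along [i], [j], [i] gives [0 <= 2 * d i j]. *)
have D_ge0 i j : 0 <= D i j.
  have := dtri i j i; rewrite (dsym j i) ((d0 i i).2 erefl) -mulr2n.
  by rewrite mxE pmulrn_lge0.
have D_diag i : D i i = 0 by rewrite mxE; exact: (d0 i i).2.
have D_sym i j : D i j = D j i by rewrite !mxE.
have D_triangle i j k : D i k <= D i j + D j k by rewrite !mxE.
have mS (theta : {set 'I_M}) := measurable_subvector (R := R) (theta := theta).
have kp := cond_distr_kernel p_cond; have kpt := cond_distr_kernel pt_cond.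
have kps theta := cond_distr_kernel (p_sub_cond theta).
have kpts theta := cond_distr_kernel (pt_sub_cond theta).
have kpS theta := prob_kernel_comp (mS theta) (kps theta).
have kptS theta := prob_kernel_comp (mS theta) (kpts theta).
pose w k1 k2 := \int[marginal P]_x wasserstein D (k1 x) (k2 x).
(* All expectations involved are finite, so the comparison can be made in [R]. *)
have EWE k1 k2 : prob_kernel k1 -> prob_kernel k2 -> EW k1 k2 = (w k1 k2)%:E.
  move=> kk1 kk2; rewrite /EW /expected_wasserstein unlock EFin_Rintegral//.
  exact: (integrable_wasserstein _ D_ge0 D_diag D_sym D_triangle kk1 kk2).
have wC k1 k2 : prob_kernel k1 -> prob_kernel k2 -> w k1 k2 = w k2 k1.
  exact: Rintegral_wasserstein_sym.
have wD k1 k2 k3 : prob_kernel k1 -> prob_kernel k2 -> prob_kernel k3 ->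
    w k1 k3 <= w k1 k2 + w k2 k3.
  exact: Rintegral_wasserstein_triangle.
have sub_le theta : w (p_sub theta \o subvector theta)
    (pt_sub theta \o subvector theta) <= w p pt.
  apply: (wasserstein_conditioning_le D_ge0 D_diag D_sym D_triangle (mS theta)
    kp kpt (kps theta) (kpts theta)) => B mB.
  - exact: (cond_distr_tower (mS theta) p_cond (p_sub_cond theta) mB).
  - rewrite !(eq_vec_integral _ _ same_marginal).
    exact: (cond_distr_tower (mS theta) pt_cond (pt_sub_cond theta) mB).
have := min2 theta1 c1; rewrite /d1 /d2 /eps1.
rewrite !(EWE _ _ kpt (kptS _)) !(EWE _ _ kp (kpS _)) (EWE _ _ kp kpt).
rewrite lee_fin -EFinB -EFinM lee_fin => {}min2.
(* The chain runs from [d1 theta2] to [d2 theta2], by minimality to [d2 theta1], and on to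
   [d1 theta1]. Each passage between [d1] and [d2] uses two triangle inequalities, with two extra
   terms bounded by [eps1]. *)
have := wD _ _ _ kp kpt (kpS theta2).
have := wD _ _ _ kpt (kptS theta2) (kpS theta2).
have := wD _ _ _ kpt kp (kptS theta1).
have := wD _ _ _ kp (kpS theta1) (kptS theta1).
have := sub_le theta1; have := sub_le theta2.
rewrite (wC _ _ kpt kp) (wC _ _ (kptS theta2) (kpS theta2)).
lra.
Qed.
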